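(* Let $H$ be a separable infinite dimensional complex Hilbert space and let $L(H)$ be the C*-algebra of bounded linear operators on $H$. Assume the Continuum Hypothesis. Then there is a nonprincipal ultrafilter $\mathcal{V}$ on $\mathbb{N}$ such that $F_{\mathcal{V}}(L(H)) = \mathbb{C}$.
   Context: For a C*-algebra $A$ and an ultrafilter $\mathcal{V}$ on $\mathbb{N} = \{0,1,2,\dots\}$, let $\ell^\infty(A)$ be the C*-algebra of all norm-bounded sequences in $A$, let $c_{\mathcal{V}}(A) = \{(a_n) \in \ell^\infty(A) : \lim_{n\to\mathcal{V}} \|a_n\| = 0\}$ (a norm-closed two-sided ideal), and let $A^{\mathcal{V}} = \ell^\infty(A)/c_{\mathcal{V}}(A)$ be the (norm) ultrapower. $A$ is identified with the image in $A^{\mathcal{V}}$ of the constant sequences. For $A \subseteq B$, $A' \cap B = \{b \in B : ab = ba \text{ for all } a \in A\}$. $F_{\mathcal{V}}(A)$ is the quotient of $A' \cap A^{\mathcal{V}}$ by the annihilator $\{b \in A^{\mathcal{V}} : ba = 0 \text{ for all } a \in A\}$; if $A$ is unital the annihilator is trivial and $F_{\mathcal{V}}(A) = A' \cap A^{\mathcal{V}}$. The symbol $\mathbb{C}$ in ''$F_{\mathcal{V}}(L(H)) = \mathbb{C}$'' denotes the scalar multiples of the identity. *)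

(* Defs.v *)
From HB Require Import structures.
From mathcomp Require Import all_boot all_order all_algebra.
From mathcomp Require Import ring_quotient sesquilinear.
From mathcomp Require Import complex.
From mathcomp Require Import all_classical all_reals all_analysis.

Set Implicit Arguments.
Unset Strict Implicit.
Unset Printing Implicit Defensive.

Import Order.TTheory GRing.Theory Num.Theory.
Import numFieldNormedType.Exports.

Local Open Scope classical_set_scope.
Local Open Scope ring_scope.
Local Open Scope quotient_scope.

(* The continuum is realized as the power set of nat. *)
Definition continuum_hypothesis : Prop :=
  forall X : set (set nat), countable X \/ (X #= [set: set nat])%card.

Record ultrafilter (T : Type) := Ultrafilter {
  ultra_sets :> set_system T;
  ultra_sets_ultra : UltraFilter ultra_sets }.

#[global] Existing Instance ultra_sets_ultra.

Definition nonprincipal (T : Type) (V : ultrafilter T) : Prop :=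
  forall x : T, (V : set_system T) <> principal_filter x.

Definition separable_space (T : topologicalType) : Prop :=
  exists2 D : set T, countable D & dense D.

Definition finite_dimensional (K : pzRingType) (E : lmodType K) : Prop :=
  exists (n : nat) (e : 'I_n -> E),
    forall x, exists c : 'I_n -> K, x = \sum_(i < n) c i *: e i.

(* The norm of H is the one given by the inner product dot, which is linear in
   the first variable and conjugate-linear in the second. *)
Definition hilbert_norm (R : realType) (H : normedModType R[i])
    (dot : {dot H for Num.conj}) : Prop :=
  forall x : H, `|x| ^+ 2 = dot x x.

(* Unital normed algebras over K; C*-algebras are used below only through this
   structure, as the involution and completeness play no role in the definition
   of the sets A^V and F_V(A). The product is a field of the mixin, not a
   GRing.PzRing product: HB cannot join PzRing with NormedModule above
   Num.NumDomain, where the norm takes its values in the ring itself. *)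
HB.mixin Record NormedModule_isNormedAlgebra (K : numFieldType) A
    of NormedModule K A := {
  nalg_one : A;
  nalg_mul : A -> A -> A;
  nalg_mulA : associative nalg_mul;
  nalg_mul1l : left_id nalg_one nalg_mul;
  nalg_mul1r : right_id nalg_one nalg_mul;
  nalg_mulDl : left_distributive nalg_mul +%R;
  nalg_mulDr : right_distributive nalg_mul +%R;
  nalg_scaleAl : forall (k : K) x y, k *: nalg_mul x y = nalg_mul (k *: x) y;
  nalg_scaleAr : forall (k : K) x y, k *: nalg_mul x y = nalg_mul x (k *: y);
  nalg_normM : forall x y : A, `|nalg_mul x y| <= `|x| * `|y| }.

#[short(type="normedAlgType")]
HB.structure Definition NormedAlgebra (K : numFieldType) :=
  {A of NormedModule K A & NormedModule_isNormedAlgebra K A}.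

Lemma nalg_mulBl (K : numFieldType) (A : normedAlgType K) (x y z : A) :
  nalg_mul (x - y) z = nalg_mul x z - nalg_mul y z.
Proof. by rewrite -scaleN1r nalg_mulDl -nalg_scaleAl scaleN1r. Qed.

Lemma nalg_mulBr (K : numFieldType) (A : normedAlgType K) (x y z : A) :
  nalg_mul z (x - y) = nalg_mul z x - nalg_mul z y.
Proof. by rewrite -scaleN1r nalg_mulDr -nalg_scaleAr scaleN1r. Qed.

Section BoundedSequences.
Variables (K : numFieldType) (A : normedAlgType K).
Implicit Types a b : nat -> A.

Definition bounded_seq : {pred nat -> A} := fun a => `[< bounded_fun a >].

Lemma bounded_seqP a :
  reflect (exists M : K, forall n, `|a n| <= M) (a \in bounded_seq).
Proof.
have FT : ProperFilter (globally [set: nat]).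
  exact: (@globally_properfilter _ _ 0%N).
apply: (iffP idP) => [/asboolP ba|[M aM]].
  have [/(_ ba)[M aM] _] := ex_bound a (F := globally setT).
  by exists M => n; exact: aM.
apply/asboolP/(ex_bound a (F := globally setT)).2.
by exists M => n _ /=.
Qed.

Lemma bounded_seq_submod : submod_closed bounded_seq.
Proof.
split; first by apply/bounded_seqP; exists 0 => n; rewrite normr0.
move=> k a b /bounded_seqP[M aM] /bounded_seqP[N bN].
apply/bounded_seqP; exists (`|k| * M + N) => n.
by rewrite (le_trans (ler_normD _ _))// lerD// normrZ ler_wpM2l//.
Qed.

HB.instance Definition _ := GRing.isSubmodClosed.Build K _ bounded_seq
  (GRing.submod_closed_semi bounded_seq_submod).

Record linfty := Linfty {
  linfty_val :> nat -> A;
  linfty_bounded : linfty_val \in bounded_seq }.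

HB.instance Definition _ := [isSub for linfty_val].
HB.instance Definition _ := [Choice of linfty by <:].
HB.instance Definition _ := [SubChoice_isSubZmodule of linfty by <:].
HB.instance Definition _ := [SubZmodule_isSubLmodule of linfty by <:].

Lemma linfty_ext (x y : linfty) : (forall n, x n = y n) -> x = y.
Proof. by move=> xy; apply/val_inj/funext. Qed.

Lemma cst_bounded (x : A) : (fun=> x) \in bounded_seq.
Proof. by apply/bounded_seqP; exists `|x| => n. Qed.

Definition linfty_cst (x : A) : linfty := Linfty (cst_bounded x).

Lemma mul_bounded (a b : linfty) :
  (fun n => nalg_mul (a n) (b n)) \in bounded_seq.
Proof.
have /bounded_seqP[M aM] := linfty_bounded a.
have /bounded_seqP[N bN] := linfty_bounded b.
apply/bounded_seqP; exists (M * N) => n.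
by rewrite (le_trans (nalg_normM _ _))// ler_pM.
Qed.

Definition linfty_mul (a b : linfty) : linfty := Linfty (mul_bounded a b).

Fact linfty_mulA : associative linfty_mul.
Proof. by move=> a b c; apply: linfty_ext => n /=; exact: nalg_mulA. Qed.

Fact linfty_mul1l : left_id (linfty_cst nalg_one) linfty_mul.
Proof. by move=> a; apply: linfty_ext => n /=; exact: nalg_mul1l. Qed.

Fact linfty_mul1r : right_id (linfty_cst nalg_one) linfty_mul.
Proof. by move=> a; apply: linfty_ext => n /=; exact: nalg_mul1r. Qed.

Fact linfty_mulDl : left_distributive linfty_mul +%R.
Proof. by move=> a b c; apply: linfty_ext => n /=; exact: nalg_mulDl. Qed.

Fact linfty_mulDr : right_distributive linfty_mul +%R.
Proof. by move=> a b c; apply: linfty_ext => n /=; exact: nalg_mulDr. Qed.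

HB.instance Definition _ := GRing.Zmodule_isPzRing.Build linfty
  linfty_mulA linfty_mul1l linfty_mul1r linfty_mulDl linfty_mulDr.

End BoundedSequences.
Arguments linfty {K} A.

Section Ultrapower.
Variables (K : numFieldType) (A : normedAlgType K) (V : ultrafilter nat).

Definition c_ultra : {pred linfty A} :=
  fun a => `[< (fun n => `|a n|) @ ultra_sets V --> (0 : K) >].

Lemma c_ultraP (a : linfty A) :
  reflect (forall e : K, 0 < e -> \forall n \near ultra_sets V, `|a n| < e)
    (a \in c_ultra).
Proof.
apply: (iffP idP) => [/asboolP a0 e e0|a0].
  by move/cvgr0Pnorm_lt: a0 => /(_ e e0); apply: filterS => n; rewrite normr_id.
apply/asboolP/cvgr0Pnorm_lt => e e0.
by apply: filterS (a0 e e0) => n; rewrite normr_id.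
Qed.

Lemma c_ultraMl (a b : linfty A) : b \in c_ultra -> a * b \in c_ultra.
Proof.
have /bounded_seqP[M aM] := linfty_bounded a.
have M0 : 0 <= M by rewrite (le_trans _ (aM 0%N)).
move=> /c_ultraP b0; apply/c_ultraP => e e0.
have M1 : 0 < M + 1 by rewrite ltr_wpDl.
apply: filterS (b0 (e / (M + 1)) (divr_gt0 e0 M1)) => n bn.
rewrite (le_lt_trans (nalg_normM _ _))//.
rewrite (@le_lt_trans _ _ ((M + 1) * `|b n|))//; last by rewrite mulrC -ltr_pdivlMr.
by rewrite ler_wpM2r// (le_trans (aM n))// lerDl.
Qed.

Lemma c_ultraMr (a b : linfty A) : a \in c_ultra -> a * b \in c_ultra.
Proof.
have /bounded_seqP[M bM] := linfty_bounded b.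
have M0 : 0 <= M by rewrite (le_trans _ (bM 0%N)).
move=> /c_ultraP a0; apply/c_ultraP => e e0.
have M1 : 0 < M + 1 by rewrite ltr_wpDl.
apply: filterS (a0 (e / (M + 1)) (divr_gt0 e0 M1)) => n an.
rewrite (le_lt_trans (nalg_normM _ _))//.
rewrite (@le_lt_trans _ _ (`|a n| * (M + 1)))//; last by rewrite -ltr_pdivlMr.
by rewrite ler_wpM2l// (le_trans (bM n))// lerDl.
Qed.

Fact c_ultra_submod : submod_closed c_ultra.
Proof.
split.
  apply/c_ultraP => e e0; apply: filterE => n.
  by rewrite [X in `|X|](_ : _ = 0)// normr0.
move=> k a b /c_ultraP a0 /c_ultraP b0; apply/c_ultraP => e e0.
have k1 : 0 < `|k| + 1 by rewrite ltr_wpDl.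
have ek : 0 < e / 2 / (`|k| + 1) by rewrite !divr_gt0.
apply: filterS2 (a0 _ ek) (b0 (e / 2) (divr_gt0 e0 (ltr0n _ 2))) => n an bn.
rewrite (le_lt_trans (ler_normD _ _))// (splitr e) ltrD// normrZ.
rewrite (@le_lt_trans _ _ ((`|k| + 1) * `|a n|))//.
  by rewrite ler_wpM2r// lerDl.
by rewrite mulrC -ltr_pdivlMr.
Qed.

HB.instance Definition _ := GRing.isSubmodClosed.Build K _ c_ultra
  (GRing.submod_closed_semi c_ultra_submod).

Definition ultrapower := {ideal_quot c_ultra}.

HB.instance Definition _ := GRing.Zmodule.on ultrapower.
HB.instance Definition _ := EqQuotient.on ultrapower.

Definition upi (a : linfty A) : ultrapower := \pi a.

Lemma upiP (x : ultrapower) : exists a, x = upi a.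
Proof. by exists (repr x); rewrite /upi reprK. Qed.

Lemma upi_eq (a b : linfty A) : upi a = upi b <-> a - b \in c_ultra.
Proof.
by rewrite Quotient.idealrBE; split => [/eqP//|/eqP].
Qed.

Definition umul (x y : ultrapower) : ultrapower := upi (repr x * repr y).
Definition uscale (k : K) (x : ultrapower) : ultrapower := upi (k *: repr x).

Lemma upiD a b : upi a + upi b = upi (a + b).
Proof. exact/esym/(raddfD (\pi_ultrapower)). Qed.

Lemma repr_upi a : repr (upi a) - a \in c_ultra.
Proof. by apply/upi_eq; rewrite /upi reprK. Qed.

Lemma upiM a b : umul (upi a) (upi b) = upi (a * b).
Proof.
apply/upi_eq; set a' := repr _; set b' := repr _.
have -> : a' * b' - a * b = a' * (b' - b) + (a' - a) * b.
  by rewrite mulrBr mulrBl addrA subrK.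
by apply: rpredD; [apply: c_ultraMl|apply: c_ultraMr]; exact: repr_upi.
Qed.

Lemma upiZ k a : uscale k (upi a) = upi (k *: a).
Proof. by apply/upi_eq; rewrite -scalerBr rpredZ// repr_upi. Qed.

Fact umulA : associative umul.
Proof.
move=> x y z; have [a ->] := upiP x; have [b ->] := upiP y.
by have [c ->] := upiP z; rewrite !upiM mulrA.
Qed.

Fact umul1l : left_id (upi 1) umul.
Proof. by move=> x; have [a ->] := upiP x; rewrite upiM mul1r. Qed.

Fact umul1r : right_id (upi 1) umul.
Proof. by move=> x; have [a ->] := upiP x; rewrite upiM mulr1. Qed.

Fact umulDl : left_distributive umul +%R.
Proof.
move=> x y z; have [a ->] := upiP x; have [b ->] := upiP y.
by have [c ->] := upiP z; rewrite upiD !upiM upiD mulrDl.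
Qed.

Fact umulDr : right_distributive umul +%R.
Proof.
move=> x y z; have [a ->] := upiP x; have [b ->] := upiP y.
by have [c ->] := upiP z; rewrite upiD !upiM upiD mulrDr.
Qed.

HB.instance Definition _ := GRing.Zmodule_isPzRing.Build ultrapower
  umulA umul1l umul1r umulDl umulDr.

Fact uscaleA k l x : uscale k (uscale l x) = uscale (k * l) x.
Proof. by have [a ->] := upiP x; rewrite !upiZ scalerA. Qed.

Fact uscale1 : left_id 1 uscale.
Proof. by move=> x; have [a ->] := upiP x; rewrite upiZ scale1r. Qed.

Fact uscaleDr : right_distributive uscale +%R.
Proof.
move=> k x y; have [a ->] := upiP x; have [b ->] := upiP y.
by rewrite upiD !upiZ upiD scalerDr.
Qed.

Fact uscaleDl x : {morph uscale^~ x : k l / k + l}.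
Proof. by move=> k l; have [a ->] := upiP x; rewrite !upiZ upiD scalerDl. Qed.

HB.instance Definition _ := GRing.Zmodule_isLmodule.Build K ultrapower
  uscaleA uscale1 uscaleDr uscaleDl.

Definition diagonal (x : A) : ultrapower := upi (linfty_cst x).

End Ultrapower.
Arguments ultrapower {K} A V.
Arguments diagonal {K A} V x.

Definition relative_commutant (B : pzRingType) (S : set B) : set B :=
  [set b | forall s, S s -> s * b = b * s].

Definition left_annihilator (B : pzRingType) (S : set B) : set B :=
  [set b | forall s, S s -> b * s = 0].

Definition coset (B : zmodType) (I : set B) (b : B) : set B :=
  [set b + i | i in I].

(* F_V(A), as a quotient set: the cosets of the annihilator of A in A^V of the
   elements of A^V that commute with A. *)
Definition F_ultra (K : numFieldType) (A : normedAlgType K)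
    (V : ultrafilter nat) : set (set (ultrapower A V)) :=
  coset (left_annihilator (range (diagonal V))) @`
    relative_commutant (range (diagonal V)).

(* The image in F_V(A) of the scalar multiples of the identity of A^V. *)
Definition F_scalars (K : numFieldType) (A : normedAlgType K)
    (V : ultrafilter nat) : set (set (ultrapower A V)) :=
  [set coset (left_annihilator (range (diagonal V)))
         (k *: (1 : ultrapower A V)) | k in [set: K]].

Arguments F_ultra {K} A V.
Arguments F_scalars {K} A V.

Section BoundedOperators.
Variables (R : realType) (H : normedModType R[i]).
Local Notation C := R[i].

Definition bounded_op : {pred H -> H} := fun f =>
  `[< linear f /\ exists M : C, forall x, `|f x| <= M * `|x| >].

Fact bounded_op_submod : submod_closed bounded_op.
Proof.
split.
  apply/asboolP; split; first by move=> k x y; rewrite scaler0 addr0.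
  by exists 0 => x; rewrite normr0 mul0r.
move=> k f g /asboolP[fl [M fM]] /asboolP[gl [N gN]]; apply/asboolP; split.
  move=> l x y; rewrite !fctE fl gl !scalerDr !scalerA mulrC.
  by rewrite addrACA.
exists (`|k| * M + N) => x.
by rewrite (le_trans (ler_normD _ _))// mulrDl lerD// normrZ -mulrA ler_wpM2l//.
Qed.

HB.instance Definition _ := GRing.isSubmodClosed.Build C _ bounded_op
  (GRing.submod_closed_semi bounded_op_submod).

Record LH := Bop { op_val :> H -> H; op_bounded : op_val \in bounded_op }.

HB.instance Definition _ := [isSub for op_val].
HB.instance Definition _ := [Choice of LH by <:].
HB.instance Definition _ := [SubChoice_isSubZmodule of LH by <:].
HB.instance Definition _ := [SubZmodule_isSubLmodule of LH by <:].

Lemma op_linear (f : LH) : linear f.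
Proof. by have /asboolP[] := op_bounded f. Qed.

HB.instance Definition _ (f : LH) :=
  GRing.isLinear.Build C H H *:%R f (op_linear f).

Lemma op_ext (f g : LH) : (forall x, f x = g x) -> f = g.
Proof. by move=> fg; apply/val_inj/funext. Qed.

(* The norm of a normed module over C takes its values in C. *)
Lemma normRe (E : normedModType C) (x : E) : (complex.Re `|x|)%:C%C = `|x|.
Proof. by rewrite RRe_real// normr_real. Qed.

Definition opnorm (f : LH) : R :=
  sup [set complex.Re `|f x| | x in [set x : H | `|x| <= 1]].

Lemma opnorm_has_sup (f : LH) :
  has_sup [set complex.Re `|f x| | x in [set x : H | `|x| <= 1]].
Proof.
split; first by exists (complex.Re `|f 0|), 0 => //=; rewrite normr0.
have /asboolP[_ [M fM]] := op_bounded f.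
exists (complex.Re `|M|) => _ [x x1 <-].
rewrite -lecR normRe RRe_real ?normr_real// (le_trans (fM x))//.
have [->|x0] := eqVneq x 0; first by rewrite normr0 mulr0.
have nx0 : 0 < `|x| by rewrite normr_gt0.
have M0 : 0 <= M by rewrite -(pmulr_lge0 _ nx0) (le_trans _ (fM x)).
by rewrite ger0_norm// ler_piMr.
Qed.

Lemma opnorm_ge0 (f : LH) : 0 <= opnorm f.
Proof.
apply: (@le_trans _ _ (complex.Re `|f 0|)); last first.
  by apply: ub_le_sup; [case: (opnorm_has_sup f)|exists 0 => //=; rewrite normr0].
by rewrite -lecR normRe; exact: normr_ge0.
Qed.

Lemma opnorm_ub (f : LH) (x : H) : `|f x| <= (opnorm f)%:C%C * `|x|.
Proof.
have [->|x0] := eqVneq x 0; first by rewrite linear0 !normr0 mulr0.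
have nx0 : 0 < `|x| by rewrite normr_gt0.
rewrite -ler_pdivrMr//.
have -> : `|f x| / `|x| = `|f (`|x|^-1 *: x)|.
  by rewrite linearZ normrZ ger0_norm ?invr_ge0// mulrC.
rewrite -normRe lecR; apply: ub_le_sup; first by case: (opnorm_has_sup f).
by exists (`|x|^-1 *: x) => //=; rewrite normrZ ger0_norm ?invr_ge0// mulVf ?gt_eqF.
Qed.

Lemma opnorm_le (f : LH) (c : R) : 0 <= c ->
  (forall x, `|f x| <= c%:C%C * `|x|) -> opnorm f <= c.
Proof.
move=> c0 fc; apply: ge_sup; first by case: (opnorm_has_sup f).
move=> _ /= [x x1 <-]; rewrite -lecR normRe (le_trans (fc x))// ler_piMr//.
by rewrite ler0c.
Qed.

Let norm (f : LH) : C := (opnorm f)%:C%C.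

Fact opnormD f g : norm (f + g) <= norm f + norm g.
Proof.
rewrite -rmorphD lecR; apply: opnorm_le; first by rewrite addr_ge0// opnorm_ge0.
move=> x; rewrite rmorphD mulrDl (le_trans (ler_normD (f x) (g x)))//.
by rewrite lerD// opnorm_ub.
Qed.

Fact opnormZ_le k f : norm (k *: f) <= `|k| * norm f.
Proof.
have [c cE] : exists c : R, c%:C%C = `|k|.
  by exists (complex.Re `|k|); rewrite RRe_real ?normr_real.
have c0 : 0 <= c by rewrite -ler0c cE.
rewrite -cE -rmorphM lecR; apply: opnorm_le.
  by apply: mulr_ge0 => //; exact: opnorm_ge0.
move=> x; rewrite rmorphM/= -mulrA cE.
by rewrite [X in `|X|](_ : _ = k *: f x)// normrZ ler_wpM2l// opnorm_ub.
Qed.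

Fact opnormZ k f : norm (k *: f) = `|k| * norm f.
Proof.
apply/eqP; rewrite eq_le opnormZ_le/=.
have [->|k0] := eqVneq k 0; first by rewrite normr0 mul0r ler0c opnorm_ge0.
rewrite -ler_pdivlMl ?normr_gt0//.
by have := opnormZ_le k^-1 (k *: f); rewrite scalerA mulVf// scale1r normfV.
Qed.

Fact opnorm_eq0 f : norm f = 0 -> f = 0.
Proof.
move=> f0; apply: op_ext => x; apply/normr0_eq0/le_anti.
by rewrite normr_ge0 andbT (le_trans (opnorm_ub f x))// -/(norm f) f0 mul0r.
Qed.

HB.instance Definition _ :=
  Lmodule_isNormed.Build C LH opnormD opnormZ opnorm_eq0.

Lemma op_normE (f : LH) : `|f| = (opnorm f)%:C%C.
Proof. by []. Qed.

Fact id_bounded : id \in bounded_op.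
Proof. by apply/asboolP; split=> //; exists 1 => x; rewrite mul1r. Qed.

Fact comp_bounded (f g : LH) : f \o g \in bounded_op.
Proof.
apply/asboolP; split; first by move=> k x y /=; rewrite !linearP.
exists ((opnorm f)%:C%C * (opnorm g)%:C%C) => x /=.
rewrite (le_trans (opnorm_ub f _))// -mulrA ler_wpM2l ?opnorm_ub//.
by rewrite ler0c opnorm_ge0.
Qed.

Definition op_id : LH := Bop id_bounded.
Definition op_comp (f g : LH) : LH := Bop (comp_bounded f g).

Fact op_compA : associative op_comp.
Proof. by move=> f g h; exact: op_ext. Qed.

Fact op_comp1l : left_id op_id op_comp.
Proof. by move=> f; exact: op_ext. Qed.

Fact op_comp1r : right_id op_id op_comp.
Proof. by move=> f; exact: op_ext. Qed.

Fact op_compDl : left_distributive op_comp +%R.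
Proof. by move=> f g h; exact: op_ext. Qed.

Fact op_compDr : right_distributive op_comp +%R.
Proof. by move=> f g h; apply: op_ext => x /=; exact: linearD. Qed.

Fact op_compZl (k : C) f g : k *: op_comp f g = op_comp (k *: f) g.
Proof. exact: op_ext. Qed.

Fact op_compZr (k : C) f g : k *: op_comp f g = op_comp f (k *: g).
Proof. by apply: op_ext => x /=; exact/esym/linearZ. Qed.

Fact op_normM (f g : LH) : `|op_comp f g| <= `|f| * `|g|.
Proof.
rewrite !op_normE -rmorphM lecR; apply: opnorm_le.
  by rewrite mulr_ge0// opnorm_ge0.
move=> x /=; rewrite (le_trans (opnorm_ub f _))// rmorphM -mulrA.
by rewrite ler_wpM2l ?opnorm_ub// ler0c opnorm_ge0.
Qed.

HB.instance Definition _ := NormedModule_isNormedAlgebra.Build C LH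
  op_compA op_comp1l op_comp1r op_compDl op_compDr op_compZl op_compZr op_normM.

End BoundedOperators.
Arguments LH {R} H.

(* Main.v *)
Require Import Defs.
From mathcomp Require Import all_boot all_order all_algebra.
From mathcomp Require Import sesquilinear complex.
From mathcomp Require Import all_classical all_reals all_analysis.
From mathcomp Require Import ring.

(** Under the continuum hypothesis, the sequences in [L(H)] can be indexed by a
    well-order with countable initial segments. Along it one builds a tower of
    infinite subsets of [nat], decreasing modulo finite sets, such that for each
    sequence [a] some member [Y] of the tower satisfies one of:
    - for some [b], the norms of the commutators [[b, a n]], [n] in [Y], are
      bounded away from [0];
    - [a n - <a n u, u>] tends to [0] in norm along [Y], [u] being a fixed unit
      vector.
    An ultrafilter containing the tower works: the first case excludes [a] from
    the relative commutant, and in the second case [a] agrees in the ultrapower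
    with the limit of the scalars [<a n u, u>].

    The dichotomy holds because an ordinary norm-central sequence in [L(H)] is
    asymptotically scalar. Commutators with rank one operators show that
    [a' n := a n - <a n u, u>] satisfies [a' n^* v --> 0] for all [v]. If [a' n]
    did not tend to [0], a gliding hump would give vectors [x k], indices [n k]
    and an orthonormal sequence [w k] with [<a' (n k) x k, w k>] at least a
    fixed multiple of the norm of [x k], and [a' (n k)^* w (k-1)] small; the
    commutators of the [a' (n k)] with the backward shift
    [w k |-> w (k-1)] would then be bounded below. *)

Set Implicit Arguments.
Unset Strict Implicit.
Unset Printing Implicit Defensive.

Import Order.TTheory GRing.Theory Num.Theory.
Import numFieldNormedType.Exports.

Local Open Scope classical_set_scope.
Local Open Scope ring_scope.

(** * Ultrafilters from the continuum hypothesis *)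

(** Well-order the power set of [nat]. If some initial segment is uncountable, the shortest such
    segment is equipotent to the whole power set by CH, and the order pulled back along a bijection
    has countable initial segments by minimality. *)
Lemma ch_well_order : continuum_hypothesis ->
  exists lt : set nat -> set nat -> Prop,
    [/\ well_founded lt, forall x y, lt x y \/ x = y \/ lt y x
      & forall x, countable [set y | lt y x]].
Proof.
move=> CH.
have [R Rwo] := wochoice.well_ordering_principle {classic set nat}.
pose lt (x y : set nat) := ~~ R y x.
have min_ex (A : set (set nat)) : A !=set0 ->
    exists2 x, A x & forall y, A y -> ~ lt y x.
  move=> [a Aa]; have [|z [[zA zmin] _]] := Rwo (fun x => x \in A).
    by exists a; apply/mem_set.
  exists z; first exact/set_mem.
  by move=> y /mem_set yA; apply/negP; rewrite negbK; exact: zmin.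
have lt_wf : well_founded lt.
  move=> a; apply: contrapT => aN.
  have [z zN zmin] := min_ex [set x | ~ Acc lt x] (ex_intro _ a aN).
  by apply: zN; constructor => y yz; apply: contrapT => /zmin.
have lt_total x y : lt x y \/ x = y \/ lt y x.
  have Rwo' : @wochoice.wo_chain {classic set nat} R predT.
    by move=> A _; exact: Rwo.
  have Rtot : R x y || R y x by exact: (wochoice.wo_chainW Rwo').
  have Ranti : R x y && R y x -> x = y.
    exact: (wochoice.wo_chain_antisymmetric Rwo').
  rewrite /lt; case: (R x y) (R y x) Rtot Ranti => [] [] //= _ xy.
  - by right; left; apply: xy.
  - by left.
  - by right; right.
have [cnt|/existsNP ncnt] :=
    pselect (forall x, countable [set y | lt y x]).
  by exists lt; split.
have [x xN xmin] := min_ex [set x | ~ countable [set y | lt y x]] ncnt.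
have [//|/card_esym/card_set_bijP[f [fS fI _]]] := CH [set y | lt y x].
have {}fI : injective f by move=> u v; apply: fI; rewrite inE.
exists (fun u v => lt (f u) (f v)); split.
- move=> u; elim/(well_founded_ind lt_wf): {u}(f u) {-2}u (erefl (f u)).
  move=> a IH u ua; constructor => v vu; apply: (IH (f v)) => //.
  by rewrite -ua.
- by move=> u v; have [|[/fI|]] := lt_total (f u) (f v); auto.
- move=> v; have fv : lt (f v) x by exact: fS.
  have /countable_injP[g gI] : countable [set y | lt y (f v)].
    by apply: contrapT => /xmin; apply.
  apply/countable_injP; exists (g \o f) => a b; rewrite !inE => av bv /= gfab.
  by apply/fI/gI => //; rewrite inE.
Qed.

Lemma infinite_natP (S : set nat) :
  infinite_set S <-> forall k, exists2 n, S n & (k <= n)%N.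
Proof.
split=> [Sinf k|Sunb /finite_seqP[s sE]].
  apply: contrapT => Sk; apply: Sinf.
  apply: (@sub_finite_set _ _ `I_k) (finite_II k) => n Sn /=.
  by rewrite ltnNge; apply/negP => kn; apply: Sk; exists n.
have [n] := Sunb (\max_(i <- s) i).+1.
rewrite sE /= => ns; rewrite ltnNge => /negP; apply.
by rewrite (big_rem n)//= leq_maxl.
Qed.

(** A diagonal argument: with [A] enumerated by [f], each finite intersection [Z k] is infinite, and
    choosing [s k >= k] in [Z k] gives an infinite range that leaves each [X i] only finitely
    often. *)
Lemma pseudo_intersection (I : Type) (A : set I) (X : I -> set nat) :
  countable A -> (forall i, A i -> infinite_set (X i)) ->
  (forall i j, A i -> A j ->
    finite_set (X i `\` X j) \/ finite_set (X j `\` X i)) ->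
  exists2 Y, infinite_set Y & forall i, A i -> finite_set (Y `\` X i).
Proof.
move=> /countable_injP[f fI] Xinf Xchain.
have {}fI i j : A i -> A j -> f i = f j -> i = j.
  by move=> Ai Aj; apply: fI; rewrite inE.
pose Z k := [set n | forall i, A i -> (f i < k)%N -> X i n].
have ZS k n i : A i -> f i = k -> Z k n -> X i n -> Z k.+1 n.
  move=> Ai fik Zn Xn j Aj; rewrite ltnS leq_eqVlt => /orP[/eqP fjk|];
    last exact: Zn.
  by rewrite (fI j i)// fik.
have Zinf k : infinite_set (Z k).
  (* The induction carries a [W] from the chain itself (or [setT]), almost contained in [Z k]: mere
     infinitude of [Z k] would not let the chain condition compare it with the next [X i]. *)
  suff [W Winf [_ WZ]] : exists2 W, infinite_set W &
      (W = setT \/ exists2 i, A i & W = X i) /\ finite_set (W `\` Z k).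
    move=> Zfin; apply: Winf.
    apply: sub_finite_set (_ : finite_set (Z k `|` (W `\` Z k))).
      by move=> n Wn; have [Zn|Zn] := pselect (Z k n); [left|right].
    by rewrite finite_setU.
  elim: k => [|k [W Winf [WX WZ]]].
    exists setT; first exact: infinite_nat.
    split; first by left.
    by apply: sub_finite_set (finite_set0 nat) => n [_]; apply=> i.
  have [[i Ai fik]|nok] := pselect (exists2 i, A i & f i = k); last first.
    exists W => //; split=> //.
    apply: sub_finite_set WZ => n [Wn Zn]; split=> //.
    apply: contra_not Zn => Zn j Aj.
    rewrite ltnS leq_eqVlt => /orP[/eqP fjk|]; last exact: Zn.
    by case: nok; exists j.
  have [WXi|XiW] : finite_set (W `\` X i) \/ finite_set (X i `\` W).
  - case: WX => [->|[j Aj ->]]; last exact: Xchain.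
    by right; rewrite setDT.
  - exists W => //; split=> //.
    apply: sub_finite_set (_ : finite_set ((W `\` X i) `|` (W `\` Z k))).
      move=> n [Wn ZnS]; have [Xn|Xn] := pselect (X i n); last by left.
      by right; split=> // Zn; apply: ZnS; exact: (ZS k n i).
    by rewrite finite_setU.
  - exists (X i); first exact: Xinf.
    split; first by right; exists i.
    apply: sub_finite_set (_ : finite_set ((X i `\` W) `|` (W `\` Z k))).
      move=> n [Xn ZnS]; have [Wn|Wn] := pselect (W n); last by left.
      by right; split=> // Zn; apply: ZnS; exact: (ZS k n i).
    by rewrite finite_setU.
have /choice[s sP] k : exists n, Z k n /\ (k <= n)%N.
  by have /infinite_natP/(_ k)[n] := Zinf k; exists n.
exists (range s).
  by apply/infinite_natP => k; exists (s k); [exists k|have [] := sP k].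
move=> i Ai; apply: (@sub_finite_set _ _ (s @` `I_(f i).+1)).
  move=> _ [[k _ <-] Xk]; exists k => //=; rewrite ltnNge; apply/negP => ik.
  by apply: Xk; have [+ _] := sP k; exact.
exact/finite_image/finite_II.
Qed.

(** Each [D i] is a requirement that can be met inside any infinite set. A stage of the recursion
    has only countably many predecessors, so the earlier sets have a pseudo-intersection, which is
    then shrunk to meet requirement [i]. *)
Lemma ch_generic_ultrafilter (D : set nat -> set (set nat)) :
  continuum_hypothesis ->
  (forall i X, infinite_set X ->
    exists Y, [/\ Y `<=` X, infinite_set Y & D i Y]) ->
  exists V : ultrafilter nat, \oo `<=` ultra_sets V /\
    forall i, exists2 Y, ultra_sets V Y & D i Y.
Proof.
move=> /ch_well_order[lt [lt_wf lt_total lt_cnt]] Ddense.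
pose step i (X : forall j, lt j i -> set nat) :=
  [set Y | [/\ infinite_set Y, D i Y
    & forall j (ji : lt j i), finite_set (Y `\` X j ji)]].
(* [get] returns a default value on an empty set; [XP] shows by induction that this never happens
   along the tower. *)
pose X := Fix lt_wf (fun=> set nat) (fun i X => get (step i X)).
have XE i : X i = get (step i (fun j _ => X j)).
  rewrite /X Fix_eq// => j f g fg; congr (get (step j _)).
  by apply: functional_extensionality_dep => k; exact/funext.
have XP i : step i (fun j _ => X j) (X i).
  elim/(well_founded_ind lt_wf): i => i IH; rewrite XE; apply: getPex.
  have [|j ji|j k ji ki|Z Zinf ZX] := @pseudo_intersection _ [set j | lt j i] X.
  - exact: lt_cnt.
  - by have [] := IH _ ji.
  - have [jk|[->|kj]] := lt_total j k.
    + by right; have [_ _ +] := IH _ ki; exact.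
    + by left; rewrite setDv.
    + by left; have [_ _ +] := IH _ ji; exact.
  have [Y [YZ Yinf DY]] := Ddense i Z Zinf.
  exists Y; split=> // j ji; apply: sub_finite_set (ZX j ji) => n [/YZ Zn Xn].
  by split.
(* Removing initial segments of [nat] turns the almost decreasing tower into a filter base and puts
   all cofinite sets into the filter. *)
pose F := filter_from setT (fun p : set nat * nat => X p.1 `\` `I_p.2).
have FF : ProperFilter F.
  apply: filter_from_proper; last first.
    move=> [i m] _ /=; have [/infinite_natP/(_ m)[n Xn mn] _ _] := XP i.
    by exists n; split=> //=; rewrite ltnNge mn.
  apply: filter_from_filter; first by exists (set0, 0%N).
  have chain i j : finite_set (X i `\` X j) \/ finite_set (X j `\` X i).
    have [ij|[->|ji]] := lt_total i j.
    - by right; have [_ _ +] := XP j; exact.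
    - by left; rewrite setDv.
    - by left; have [_ _ +] := XP i; exact.
  have bound (S : set nat) : finite_set S -> exists m, S `<=` `I_m.
    move=> Sfin; apply: contrapT => Sm; move: Sfin; apply/infinite_natP => k.
    apply: contrapT => Sk; apply: Sm; exists k => n Sn /=.
    by rewrite ltnNge; apply/negP => kn; apply: Sk; exists n.
  have ge_max a b n : ~ `I_(maxn a b) n -> ~ `I_a n /\ ~ `I_b n.
    move=> /= /negP; rewrite -leqNgt geq_max => /andP[an bn].
    by split; apply/negP; rewrite -leqNgt.
  move=> [i a] [j b] _ _; have [/bound[m mP]|/bound[m mP]] := chain i j.
    exists (i, maxn m (maxn a b)) => //= n [Xn] /ge_max[mn /ge_max[an bn]].
    split; split => //; apply: contrapT => Xjn; apply: mn.
    by apply: mP.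
  exists (j, maxn m (maxn a b)) => //= n [Xn] /ge_max[mn /ge_max[an bn]].
  split; split => //; apply: contrapT => Xjn; apply: mn.
  by apply: mP.
have [G [GU FG]] := ultraFilterLemma FF.
exists (Ultrafilter GU); split=> [S [m _ mS]|i].
  apply: FG; exists (set0, m) => //= n [_ /negP]; rewrite -leqNgt; exact: mS.
exists (X i); last by have [] := XP i.
by apply: FG; exists (i, 0%N) => //= n [].
Qed.

Lemma nonprincipal_cofinite (V : ultrafilter nat) :
  \oo `<=` ultra_sets V -> nonprincipal V.
Proof.
move=> ooV n VE.
have : ultra_sets V [set m | (n < m)%N] by apply: ooV; exists n.+1.
by rewrite VE => /principal_filterP /=; rewrite ltnn.
Qed.

(** Dependent choice with full history, as the gliding hump requires. *)
Lemma history_choice (T : Type) (P : seq T -> T -> Prop) :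
  (forall s, exists t, P s t) ->
  exists f : nat -> T, forall n, P (mkseq f n) (f n).
Proof.
move=> /choice[F FP]; pose S n := iter n (fun s => rcons s (F s)) [::].
exists (F \o S) => n; have -> : mkseq (F \o S) n = S n; last exact: FP.
by elim: n => //= n IH; rewrite mkseqS IH.
Qed.

Lemma infinite_not_near (X P : set nat) :
  ~ (\forall n \near \oo, X n -> P n) -> infinite_set (X `\` P).
Proof.
move=> XP; apply/infinite_natP => k; apply: contrapT => XPk; apply: XP.
exists k => // n /= kn Xn; apply: contrapT => Pn; apply: XPk.
by exists n.
Qed.

(** * Limits of complex sequences along an ultrafilter *)

Lemma exists_natSinv_lt (R : realType) (e : R[i]) :
  0 < e -> exists m : nat, m.+1%:R^-1 < e.
Proof.
move=> e0; have eE : (complex.Re e)%:C%C = e by rewrite RRe_real// gtr0_real.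
have Re0 : 0 < complex.Re e by rewrite -ltcR eE.
have [N _ /(_ N (leqnn N)) /= Ne] := near_infty_natSinv_lt (PosNum Re0).
exists N; rewrite -eE (_ : _^-1 = (N.+1%:R^-1)%:C%C) ?ltcR//.
by rewrite fmorphV rmorph_nat.
Qed.

Lemma dense_norm_lt (K : numFieldType) (E : normedModType K) (D : set E) x
    (e : K) :
  dense D -> 0 < e -> exists2 d, D d & `|x - d| < e.
Proof.
move=> Ddense e0.
have [|d [/interior_subset xd Dd]] :=
    Ddense (ball x e)^° _ (@open_interior _ _).
  by exists x; apply: nbhsx_ballx.
by exists d => //; move: xd; rewrite -ball_normE.
Qed.

(** Compactness gives a cluster point of the image of [V], and a cluster point of an ultrafilter is
    a limit. *)
Lemma bounded_ultra_cvg (R : realType) (V : ultrafilter nat) (t : nat -> R)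
    (M : R) :
  (forall n, `|t n| <= M) -> exists l : R, t @ ultra_sets V --> l.
Proof.
move=> tM.
have tV : ProperFilter (t @ ultra_sets V) by exact: fmap_proper_filter.
have [|l [_ lV]] := @segment_compact R (- M) M _ tV.
  by apply: (@filterE _ (ultra_sets V)) => n /=; rewrite in_itv/= -ler_norml.
exists l => W lW.
have [//|VW] := in_ultra_setVsetC (t @^-1` W) (ultra_sets_ultra V).
by have [r [rW Wr]] := lV (~` W) W VW lW.
Qed.

Lemma normc_ge_Im (R : realType) (z : R[i]) : `|complex.Im z|%:C%C <= `|z|.
Proof. by rewrite normc_def lecR -sqrtr_sqr ler_wsqrtr// lerDr sqr_ge0. Qed.

Lemma normc_le_ReDIm (R : realType) (z : R[i]) :
  `|z| <= (`|complex.Re z| + `|complex.Im z|)%:C%C.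
Proof.
have normR (r : R) : `|r%:C%C| = `|r|%:C%C.
  by rewrite normc_def /= expr0n addr0 sqrtr_sqr.
rewrite {1}[z]complexE (le_trans (ler_normD _ _))// normrM !normR.
by rewrite complexiE normCi mul1r rmorphD.
Qed.

Lemma bounded_ultra_cvgC (R : realType) (V : ultrafilter nat)
    (z : nat -> R[i]) (M : R[i]) :
  (forall n, `|z n| <= M) ->
  exists l, forall e, 0 < e -> \forall n \near ultra_sets V, `|z n - l| < e.
Proof.
move=> zM.
have ME : (complex.Re M)%:C%C = M.
  by rewrite RRe_real// ger0_real// (le_trans _ (zM 0%N)).
have ReM n : `|complex.Re (z n)| <= complex.Re M.
  by rewrite -lecR ME (le_trans (normc_ge_Re _)).
have ImM n : `|complex.Im (z n)| <= complex.Re M.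
  by rewrite -lecR ME (le_trans (normc_ge_Im _)).
have [r rV] := bounded_ultra_cvg V ReM.
have [s sV] := bounded_ultra_cvg V ImM.
exists (r +i* s)%C => e e0.
have eE : (complex.Re e)%:C%C = e by rewrite RRe_real// gtr0_real.
have Re0 : 0 < complex.Re e / 2 by rewrite divr_gt0// -ltcR eE.
move/cvgrPdist_lt/(_ _ Re0) : rV; move/cvgrPdist_lt/(_ _ Re0) : sV.
apply: filterS2 => n sn rn; rewrite (le_lt_trans (normc_le_ReDIm _))//.
rewrite -eE ltcR (splitr (complex.Re e)) !raddfB /=.
by rewrite distrC [X in _ + X]distrC ltrD.
Qed.

(** * Norm-central sequences of operators *)

Lemma op_norm_ub (R : realType) (H : normedModType R[i]) (f : LH H) x :
  `|f x| <= `|f| * `|x|.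
Proof. exact: opnorm_ub. Qed.

Lemma op_norm_le (R : realType) (H : normedModType R[i]) (f : LH H) (c : R[i]) :
  0 <= c -> (forall x, `|f x| <= c * `|x|) -> `|f| <= c.
Proof.
move=> c0 fc; have cE : (complex.Re c)%:C%C = c by rewrite RRe_real// ger0_real.
by rewrite op_normE -cE lecR; apply: opnorm_le => [|x]; rewrite -?ler0c cE.
Qed.

Lemma op_of_linear (R : realType) (H : normedModType R[i]) (g : H -> H)
    (M : R[i]) :
  linear g ->
  (forall x, `|g x| <= M * `|x|) -> exists f : LH H, forall x, f x = g x.
Proof.
move=> gl gM.
have gb : g \in @bounded_op R H by apply/asboolP; split=> //; exists M.
by exists (Bop gb).
Qed.

Definition commutator (R : realType) (H : normedModType R[i]) (f g : LH H) :
    LH H :=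
  nalg_mul f g - nalg_mul g f.

Lemma commutatorE (R : realType) (H : normedModType R[i]) (f g : LH H) x :
  commutator f g x = f (g x) - g (f x).
Proof. by []. Qed.

Section Hilbert.
Variables (R : realType) (H : completeNormedModType R[i]).
Variables (dot : {dot H for Num.conj}) (dotE : hilbert_norm dot).
Local Notation C := R[i].
Implicit Types (x y z v : H) (w : nat -> H) (f : LH H).

Lemma dotC x y : dot x y = (dot y x)^*.
Proof. by rewrite hermC mul1r. Qed.

Lemma dotDl x y z : dot (x + y) z = dot x z + dot y z.
Proof. by rewrite linearDl. Qed.

Lemma dotBl x y z : dot (x - y) z = dot x z - dot y z.
Proof. by rewrite linearBl. Qed.

Lemma dotZl k x z : dot (k *: x) z = k * dot x z.
Proof. by rewrite linearZl_LR. Qed.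

Lemma dotZr k x z : dot z (k *: x) = k^* * dot z x.
Proof. by rewrite linearZr_LR. Qed.

Lemma dot_unit_norm x : dot x x = 1 -> `|x| = 1.
Proof. by move=> x1; apply/eqP; rewrite -(@pexpr_eq1 _ _ 2)// dotE x1. Qed.

Lemma pythagoras x y : dot x y = 0 -> `|x + y| ^+ 2 = `|x| ^+ 2 + `|y| ^+ 2.
Proof. by move=> xy; rewrite !dotE hnormDd. Qed.

Lemma dot_suml (s : seq nat) (F : nat -> H) z :
  dot (\sum_(i <- s) F i) z = \sum_(i <- s) dot (F i) z.
Proof.
apply: (big_morph (fun x => dot x z)); last by rewrite linear0l.
by move=> x y; rewrite dotDl.
Qed.

(** The bound [N] is there because the gliding hump finds its vectors one at a time, and each step
    knows only the earlier ones to be orthonormal. *)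
Definition orthonormal_upto (N : nat) w :=
  forall i j, (i < N)%N -> (j < N)%N -> dot (w i) (w j) = (i == j)%:R.

Lemma dot_sum_orthonormal N w (c : nat -> C) m n i :
  orthonormal_upto N w -> (n <= N)%N -> (i < N)%N ->
  dot (\sum_(m <= k < n) c k *: w k) (w i) = if (m <= i < n)%N then c i else 0.
Proof.
move=> wN nN iN; rewrite dot_suml.
have E k : (m <= k < n)%N -> dot (c k *: w k) (w i) = c k * (k == i)%:R.
  by move=> /andP[_ kn]; rewrite dotZl wN// (leq_trans kn).
rewrite (eq_big_nat _ _ E); case: ifPn => [mi|mi].
  rewrite (bigD1_seq i) ?mem_index_iota ?iota_uniq//= eqxx mulr1.
  by rewrite big1 ?addr0// => k /negbTE ->; rewrite mulr0.
rewrite big_nat big1// => k mk; case: eqP => [ki|]; last by rewrite mulr0.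
by rewrite -ki mk in mi.
Qed.

Lemma norm_sum_orthonormal N w (c : nat -> C) m n :
  orthonormal_upto N w -> (n <= N)%N ->
  `|\sum_(m <= k < n) c k *: w k| ^+ 2 = \sum_(m <= k < n) `|c k| ^+ 2.
Proof.
move=> wN; elim: n => [|n IH] nN; first by rewrite !big_geq// normr0 expr0n.
have [nm|mn] := ltnP n m; first by rewrite !big_geq// normr0 expr0n.
rewrite !big_nat_recr//= -(IH (ltnW nN)) pythagoras.
  by rewrite normrZ exprMn (dotE (w n)) wN// eqxx mulr1.
rewrite dotZr (dot_sum_orthonormal _ _ wN (ltnW nN) nN).
by rewrite ltnn andbF mulr0.
Qed.

Lemma bessel N w x : orthonormal_upto N w ->
  \sum_(0 <= k < N) `|dot x (w k)| ^+ 2 <= `|x| ^+ 2.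
Proof.
move=> wN; set p := \sum_(0 <= k < N) dot x (w k) *: w k.
have pw k : (k < N)%N -> dot (x - p) (w k) = 0.
  by move=> kN; rewrite dotBl (dot_sum_orthonormal _ _ wN)// kN subrr.
have xp : dot p (x - p) = 0.
  rewrite dot_suml big_nat big1// => k kN.
  by rewrite dotZl (dotC (w k)) pw// conjC0 mulr0.
rewrite -(norm_sum_orthonormal _ _ wN)// -/p.
by rewrite -[in leRHS](subrK p x) addrC pythagoras// lerDl exprn_ge0.
Qed.

(** Cauchy-Schwarz, as Bessel's inequality for the single normalised vector [y]. *)
Lemma norm_dot x y : `|dot x y| <= `|x| * `|y|.
Proof.
have [->|y0] := eqVneq y 0; first by rewrite linear0r normr0 mulr_ge0.
have ny : `|y| != 0 by rewrite normr_eq0.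
have w1 : orthonormal_upto 1 (fun=> `|y|^-1 *: y).
  move=> [|i] [|j] // _ _; rewrite /= -dotE normrZ normfV normr_id mulVf//.
  by rewrite expr1n.
have := bessel x w1; rewrite big_nat1 ler_pXn2r ?nnegrE//.
rewrite dotZr normrM norm_conjC normfV normr_id mulrC.
by rewrite ler_pdivrMr// normr_gt0.
Qed.

Lemma exists_rank_one v z : exists f : LH H, forall x, f x = dot x v *: z.
Proof.
apply: (@op_of_linear _ _ _ (`|v| * `|z|)) => [k x y|x].
  by rewrite dotDl dotZl scalerDl scalerA.
by rewrite normrZ mulrAC ler_wpM2r// mulrC norm_dot.
Qed.

(** The operator is the backward shift [x |-> sum_k <x, w (k+1)> w k]. Bessel's inequality bounds
    the partial sums, Pythagoras turns their increments into blocks of a convergent real series, and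
    completeness of [H] gives the limit. *)
Lemma exists_shift w : (forall N, orthonormal_upto N w) ->
  exists2 f : LH H, (forall x, `|f x| <= `|x|) &
    forall x k, dot (f x) (w k) = dot x (w k.+1).
Proof.
move=> wo.
have wSo N : orthonormal_upto N (w \o S).
  by move=> i j iN jN /=; rewrite (wo N.+1).
pose u x n := \sum_(0 <= k < n) dot x (w k.+1) *: w k.
have u_norm x n : `|u x n| <= `|x|.
  rewrite -(@ler_pXn2r _ 2) ?nnegrE// (norm_sum_orthonormal _ _ (wo n))//.
  exact: (bessel x (wSo n)).
have u_cvg x : cvg (u x @ \oo).
  apply/cauchy_cvgP/cauchy_seriesP => e e0.
  have eE : (complex.Re e)%:C%C = e by rewrite RRe_real// gtr0_real.
  have e0' : 0 < complex.Re e by rewrite -ltcR eE.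
  pose t k := complex.Re `|dot x (w k.+1)| ^+ 2.
  have tE k : (t k)%:C%C = `|dot x (w k.+1)| ^+ 2.
    by rewrite /t rmorphXn; congr (_ ^+ 2); rewrite RRe_real ?normr_real.
  have tsum m n : (\sum_(m <= k < n) t k)%:C%C =
      `|\sum_(m <= k < n) dot x (w k.+1) *: w k| ^+ 2.
    rewrite (norm_sum_orthonormal _ _ (wo n))// raddf_sum.
    by apply: eq_bigr => k _; exact: tE.
  have : cauchy (series t @ \oo).
    apply: cvg_cauchy; apply: nondecreasing_is_cvgn.
      by apply: nondecreasing_series => *; exact: sqr_ge0.
    exists (complex.Re (`|x| ^+ 2)) => _ [n _ <-].
    rewrite -lecR tsum RRe_real; last by rewrite realX// normr_real.
    by rewrite ler_pXn2r ?nnegrE//; exact: u_norm.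
  move=> /cauchy_seriesP/(_ (complex.Re e ^+ 2) (exprn_gt0 2 e0')).
  apply: filterS => -[m n] /= mn.
  have : (\sum_(m <= k < n) t k)%:C%C < e ^+ 2.
    by rewrite -eE -rmorphXn/= ltcR (le_lt_trans (ler_norm _)).
  by rewrite tsum ltr_pXn2r ?nnegrE// ltW.
pose g x := lim (u x @ \oo).
have uD k x y n : u (k *: x + y) n = k *: u x n + u y n.
  rewrite /u scaler_sumr -big_split/=; apply: eq_bigr => i _.
  by rewrite dotDl dotZl scalerDl scalerA.
have g_norm x : `|g x| <= `|x|.
  apply/ler_addgt0Pr => e e0.
  have /cvgrPdist_le/(_ e e0)[N _ /(_ N (leqnn N)) gu] := u_cvg x.
  rewrite -(subrK (u x N) (g x)) addrC (le_trans (ler_normD _ _))//.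
  by rewrite lerD.
have [|x|f fE] := @op_of_linear _ _ g 1.
- move=> k x y; apply/cvg_lim; first exact: norm_hausdorff.
  rewrite [u _](_ : _ = (k \*: u x) \+ u y); last first.
    by apply/funext => n; rewrite uD.
  by apply: cvgD; [apply: cvgZr|].
- by rewrite mul1r.
exists f => [x|x k]; first by rewrite fE.
apply/eqP; rewrite -subr_eq0 -normr_le0; apply/ler_addgt0Pr => e e0.
rewrite add0r fE.
have /cvgrPdist_le/(_ e e0)[N _ gu] := u_cvg x.
(* With at least [k.+1] terms, the partial sum already has the exact coefficient at [w k]. *)
have /gu : (N <= maxn N k.+1)%N by rewrite leq_maxl.
set n := maxn _ _; move=> {}gu.
have -> : dot x (w k.+1) = dot (u x n) (w k).
  have kn : (k < n)%N by rewrite leq_maxr.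
  by rewrite (dot_sum_orthonormal _ _ (wo n))// kn.
rewrite -dotBl (le_trans (norm_dot _ _))//.
by rewrite (@dot_unit_norm (w k)) ?mulr1// (wo k.+1)// eqxx.
Qed.

(** The fourth premise says, without adjoints, that [a n^* v] tends to 0 along [S]. So for large [n]
    the vectors [a n x] have small components along the old [w i]; if [a n x] has norm above [e]
    times that of [x], removing these components leaves a large vector, and [v] is its
    normalisation. *)
Lemma gliding_step (a : nat -> LH H) (S : set nat) (e : C) w k :
  0 < e -> infinite_set S -> (forall n, S n -> e < `|a n|) ->
  (forall v d, 0 < d ->
    \forall n \near \oo, S n -> forall x, `|dot (a n x) v| <= d * `|x|) ->
  orthonormal_upto k w ->
  exists v n x, [/\ S n /\ (k <= n)%N, x != 0,
    dot v v = 1 /\ forall i, (i < k)%N -> dot v (w i) = 0,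
    e / 2 * `|x| <= `|dot (a n x) v| &
    forall i y, (i < k)%N -> `|dot (a n y) (w i)| <= e / 4 * `|y|].
Proof.
move=> e0 Sinf Sa awk wk.
(* [k%:R * d] controls the projection onto the [k] old vectors, and [d] itself the last conclusion;
   dividing by [k.+1] covers [k = 0]. *)
have [d [d0 dk d4]] : exists d : C, [/\ 0 < d, k%:R * d <= e / 4 & d <= e / 4].
  have k0 : 0 < k.+1%:R :> C by rewrite ltr0n.
  have e4 : 0 < e / 4 by rewrite divr_gt0.
  exists (e / 4 / k.+1%:R); split; first by rewrite divr_gt0.
    by rewrite mulrA ler_pdivrMr// mulrC ler_wpM2l ?ler_nat// ltW.
  by rewrite ler_pdivrMr// ler_peMr ?ler1n// ltW.
have [N Nd] : exists N, forall n, (N <= n)%N -> S n -> forall i y,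
    (i < k)%N -> `|dot (a n y) (w i)| <= d * `|y|.
  elim: k {wk dk} => [|k [N1 N1d]]; first by exists 0%N.
  have [N2 _ N2d] := awk (w k) _ d0.
  exists (maxn N1 N2) => n; rewrite geq_max => /andP[N1n N2n] Sn i y.
  rewrite ltnS leq_eqVlt => /orP[/eqP ->|ik]; first exact: (N2d n).
  exact: N1d.
have /infinite_natP/(_ (maxn N k))[n Sn] := Sinf.
rewrite geq_max => /andP[Nn kn].
have [x ax] : exists x, e * `|x| < `|a n x|.
  apply: contrapT => axN; have := Sa n Sn; apply/negP.
  rewrite -real_leNgt ?normr_real ?gtr0_real//.
  apply: op_norm_le => [|x]; first exact: ltW.
  rewrite real_leNgt ?normr_real//; last first.
    by rewrite realM ?normr_real ?gtr0_real.
  by apply/negP => ?; apply: axN; exists x.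
have x0 : x != 0.
  by apply: contraTneq ax => ->; rewrite linear0 !normr0 mulr0 ltxx.
set y := a n x in ax.
pose p := \sum_(0 <= i < k) dot y (w i) *: w i.
have pw i : (i < k)%N -> dot (y - p) (w i) = 0.
  by move=> ik; rewrite dotBl (dot_sum_orthonormal _ _ wk)// ik subrr.
have w1 i : (i < k)%N -> `|w i| = 1.
  by move=> ik; rewrite dot_unit_norm// wk// eqxx.
have p_norm : `|p| <= e / 4 * `|x|.
  rewrite (le_trans (ler_norm_sum _ _ _))// big_nat.
  rewrite (@le_trans _ _ (\sum_(0 <= i < k) d * `|x|))//.
    rewrite [leRHS]big_nat; apply: ler_sum => i ik.
    by rewrite normrZ w1// mulr1 Nd.
  by rewrite sumr_const_nat subn0 -[_ *+ k]mulr_natl mulrA ler_wpM2r.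
have r_norm : e / 2 * `|x| <= `|y - p|.
  rewrite -(lerD2r (e / 4 * `|x|)).
  apply: (@le_trans _ _ (`|y - p| + `|p|)); last by rewrite lerD2l.
  apply: le_trans (ler_normD _ _); rewrite subrK (le_trans _ (ltW ax))//.
  rewrite -mulrDl ler_wpM2r// -[leLHS]addr0.
  have eE : e = e / 2 + e / 4 + e / 4 by field.
  by rewrite [leRHS]eE lerD2l divr_ge0// ltW.
have r0 : `|y - p| != 0.
  by rewrite gt_eqF// (lt_le_trans _ r_norm)// mulr_gt0 ?divr_gt0 ?normr_gt0.
(* The component of [a n x] orthogonal to the previous [w i], normalised. *)
exists (`|y - p|^-1 *: (y - p)), n, x; split => //.
- split=> [|i ik]; last by rewrite dotZl pw// mulr0.
  by rewrite -dotE normrZ normfV normr_id mulVf// expr1n.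
- have yp : dot y (y - p) = `|y - p| ^+ 2.
    rewrite dotE dotBl; suff -> : dot p (y - p) = 0 by rewrite subr0.
    rewrite dot_suml big_nat big1// => i ik.
    by rewrite dotZl (dotC (w i)) pw// conjC0 mulr0.
  rewrite dotZr yp normrM norm_conjC normfV normrX normr_id.
  by rewrite expr2 mulKf.
- by move=> i z ik; rewrite (le_trans (Nd n Nn Sn i z ik))// ler_wpM2r.
Qed.

Lemma central_sequence (a : nat -> LH H) (X : set nat) (u : H) :
  dot u u = 1 ->
  (forall b d, 0 < d ->
    \forall n \near \oo, X n -> `|commutator b (a n)| < d) ->
  forall d, 0 < d ->
    \forall n \near \oo, X n -> `|a n - dot (a n u) u *: nalg_one| < d.
Proof.
move=> u1 acomm d d0.
pose a' n : LH H := a n - dot (a n u) u *: nalg_one.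
have a'E n x : a' n x = a n x - dot (a n u) u *: x by [].
have a'comm b n x : commutator b (a n) x = b (a' n x) - a' n (b x).
  by rewrite commutatorE !a'E linearB linearZ /= opprB addrA subrK.
have u_norm := dot_unit_norm u1.
have a'weak v c : 0 < c ->
    \forall n \near \oo, X n -> forall x, `|dot (a' n x) v| <= c * `|x|.
  (* For [b x = <x, v> u], pairing [[b, a n] x] with [u] gives [<a n x, v> - <x, v> <a n u, u>],
     which is [<a' n x, v>]. *)
  move=> c0; have [b bE] := exists_rank_one v u.
  apply: filterS (acomm b c c0) => n bn Xn x.
  have -> : dot (a' n x) v = dot (commutator b (a n) x) u.
    rewrite commutatorE a'E !dotBl !bE !dotZl [a n (_ *: _)]linearZ /=.
    by rewrite dotZl u1 mulr1 mulrC.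
  rewrite (le_trans (norm_dot _ _))// u_norm mulr1.
  by rewrite (le_trans (op_norm_ub _ _))// ler_wpM2r// ltW// bn.
apply: contrapT => /infinite_not_near; set S := X `\` _ => Sinf.
(* Halving turns the bound [d <= |a' n|] on [S] into the strict one that [gliding_step] asks for. *)
pose e := d / 2.
have e0 : 0 < e by rewrite divr_gt0.
have Sa n : S n -> e < `|a' n|.
  move=> [_ /negP]; rewrite -real_leNgt ?normr_real ?gtr0_real//.
  by apply: lt_le_trans; rewrite gtr_pMr// invf_lt1// ltr1n.
have weakS v c : 0 < c ->
    \forall n \near \oo, S n -> forall x, `|dot (a' n x) v| <= c * `|x|.
  by move=> c0; apply: filterS (a'weak v c c0) => n an [Xn _]; exact: an.
(* The triple is [(v, n, x)]. Orthonormality of the history is a premise inside [step], with a dummy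
   triple when it fails, so that [history_choice] applies; [wo] later supplies it by induction. *)
have step (s : seq (H * nat * H)) : exists t : H * nat * H,
    let w i := (nth (0, 0%N, 0) s i).1.1 in
    let k := size s in orthonormal_upto k w ->
    [/\ S t.1.2 /\ (k <= t.1.2)%N, t.2 != 0,
      dot t.1.1 t.1.1 = 1 /\ forall i, (i < k)%N -> dot t.1.1 (w i) = 0,
      e / 2 * `|t.2| <= `|dot (a' t.1.2 t.2) t.1.1| &
      forall i y, (i < k)%N -> `|dot (a' t.1.2 y) (w i)| <= e / 4 * `|y|].
  have [sw|sw] := pselect (orthonormal_upto (size s)
      (fun i => (nth (0, 0%N, 0) s i).1.1)); last by exists (0, 0%N, 0).
  have [v [n [x P]]] := gliding_step e0 Sinf Sa weakS sw.
  by exists (v, n, x).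
have [f fP] := history_choice step.
pose w i := (f i).1.1.
have wE k i : (i < k)%N -> (nth (0, 0%N, 0) (mkseq f k) i).1.1 = w i.
  by move=> ik; rewrite nth_mkseq.
have wo k : orthonormal_upto k w.
  elim: k => [//|k IH].
  have [|_ _ [fk1 fk0] _ _] := fP k.
    by rewrite size_mkseq => i j ik jk; rewrite !wE// IH.
  rewrite size_mkseq in fk0.
  have fk0' i : (i < k)%N -> dot (w k) (w i) = 0.
    by move=> ik; rewrite -[X in dot _ X](wE k)// fk0.
  move=> i j; rewrite !ltnS leq_eqVlt => /orP[/eqP ->|ik].
    rewrite leq_eqVlt => /orP[/eqP ->|jk]; first by rewrite eqxx.
    by rewrite fk0'// gtn_eqF.
  rewrite leq_eqVlt => /orP[/eqP ->|jk]; last exact: IH.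
  by rewrite dotC fk0'// conjC0 ltn_eqF.
have [b b1 bw] := exists_shift wo.
have e4 : 0 < e / 4 by rewrite divr_gt0.
have [N _ Nb] := acomm b _ e4.
(* At stage [N.+1], where [v] is [w N.+1], pairing [[b, a n] x] with [w N] gives
   [<a' n x, v> - <a' n (b x), w N>]. The first term is at least [e / 2], the second at most
   [e / 4], times the norm of [x], which contradicts [Nb]. *)
have [|] := fP N.+1.
  by rewrite size_mkseq => i j ik jk; rewrite !wE// (wo N.+1).
rewrite size_mkseq; case fN: (f N.+1) => [[v n] x] /=.
move=> [[Xn _] Nn] x0 _ vx /(_ N (b x) (ltnSn N)); rewrite wE// => ub.
have := Nb n (ltnW Nn) Xn; apply/negP.
rewrite -real_leNgt ?normr_real ?gtr0_real//.
have nx : 0 < `|x| by rewrite normr_gt0.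
rewrite -(ler_pM2r nx) (le_trans _ (op_norm_ub _ _))//.
have wN1 : `|w N| = 1 by rewrite dot_unit_norm// (wo N.+1)// eqxx.
rewrite -[leRHS]mulr1 -[X in _ <= _ * X]wN1 (le_trans _ (norm_dot _ _))//.
rewrite a'comm dotBl bw [w N.+1]/w fN /=.
rewrite -(lerD2r `|dot (a' n (b x)) (w N)|).
apply: (@le_trans _ _ `|dot (a' n x) v|); last first.
  by rewrite -[X in `|X| <= _](subrK (dot (a' n (b x)) (w N))) ler_normD.
apply: le_trans vx; rewrite (@le_trans _ _ (e / 4 * `|x| + e / 4 * `|x|))//.
  by rewrite lerD2l (le_trans ub)// ler_wpM2l// ltW.
rewrite -mulrDl ler_wpM2r//.
by have -> : e / 2 = e / 4 + e / 4 by field.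
Qed.

End Hilbert.

(** * The ultrapower of L(H) *)

(* A bounded operator is determined by its values on a countable dense set, and
   each of these values by the basic neighbourhoods of dense points in which it
   lies. *)
Lemma separable_op_seq_code (R : realType) (H : normedModType R[i]) :
  separable_space H -> exists code : (nat -> LH H) -> set nat, injective code.
Proof.
move=> [D /countable_injP[g gI] Ddense].
have {}gI x y : D x -> D y -> g x = g y -> x = y.
  by move=> Dx Dy; apply: gI; rewrite inE.
pose code (a : nat -> LH H) := [set k | exists n x y m, [/\ D x, D y,
  k = pickle (n, g x, g y, m) & `|a n x - y| < m.+1%:R^-1]].
exists code => a b ab.
have codeP c n x y m : D x -> D y ->
    code c (pickle (n, g x, g y, m)) -> `|c n x - y| < m.+1%:R^-1.
  move=> Dx Dy [n' [x' [y' [m' [Dx' Dy' /(pcan_inj pickleK)[-> xx yy ->]]]]]].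
  by rewrite (gI _ _ Dx Dx' xx) (gI _ _ Dy Dy' yy).
have abD n x : D x -> a n x = b n x.
  move=> Dx; apply/eqP; rewrite -subr_eq0 -normr_le0.
  apply/ler_addgt0Pr => e e0.
  have e2 : 0 < e / 2 by rewrite divr_gt0.
  have [m me] := exists_natSinv_lt e2; rewrite add0r.
  have m0 : 0 < m.+1%:R^-1 :> R[i] by rewrite invr_gt0 ltr0n.
  have [y Dy axy] := dense_norm_lt (a n x) Ddense m0.
  have bxy : `|b n x - y| < m.+1%:R^-1.
    by apply: codeP => //; rewrite -ab; exists n, x, y, m.
  rewrite -(subrK y (a n x)) -addrA -[y - _]opprB.
  rewrite (le_trans (ler_normB _ _))// (splitr e) lerD//.
    by rewrite (le_trans (ltW axy))// ltW.
  by rewrite (le_trans (ltW bxy))// ltW.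
apply/funext => n; apply: op_ext => x.
apply/eqP; rewrite -subr_eq0 -normr_le0.
apply/ler_addgt0Pr => e e0; rewrite add0r.
have M0 : 0 < `|a n| + `|b n| + 1 by rewrite ltr_wpDl ?addr_ge0.
have [d Dd xd] := dense_norm_lt x Ddense (divr_gt0 e0 M0).
have -> : a n x - b n x = a n (x - d) - b n (x - d).
  rewrite [a n (x - d)]linearB [b n (x - d)]linearB /= (abD n d Dd).
  by rewrite opprB addrA subrK.
rewrite (le_trans (ler_normB _ _))//.
rewrite (le_trans (lerD (op_norm_ub _ _) (op_norm_ub _ _)))// -mulrDl.
rewrite -(divfK (lt0r_neq0 M0) e) mulrC ler_pM ?addr_ge0//; first exact: ltW.
by rewrite lerDl.
Qed.

Lemma exists_unit_vector (R : realType) (H : normedModType R[i])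
    (dot : {dot H for Num.conj}) :
  hilbert_norm dot -> ~ finite_dimensional H -> exists u, dot u u = 1.
Proof.
move=> dotE Hinf; have [x x0] : exists x : H, x != 0.
  apply: contrapT => H0; apply: Hinf; exists 0%N, (fun=> 0) => x.
  exists (fun=> 0); rewrite big_ord0; apply/eqP; apply: contrapT => /negP x0.
  by apply: H0; exists x.
exists (`|x|^-1 *: x); rewrite -dotE normrZ normfV normr_id mulVf ?expr1n//.
by rewrite normr_eq0.
Qed.

Lemma scalar_central (K : numFieldType) (A : normedAlgType K)
    (V : ultrafilter nat) (k : K) :
  relative_commutant (range (Defs.diagonal V)) (k *: (1 : ultrapower A V)).
Proof.
move=> _ [x _ <-].
have -> : k *: (1 : ultrapower A V) = upi V (k *: (1 : linfty _)).
  exact: upiZ.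
rewrite [LHS]upiM [RHS]upiM; congr upi; apply: linfty_ext => n.
change (nalg_mul x (k *: nalg_one) = nalg_mul (k *: nalg_one) x).
by rewrite -nalg_scaleAl -nalg_scaleAr nalg_mul1l nalg_mul1r.
Qed.

Theorem theorem2 (R : realType) (H : completeNormedModType R[i])
    (dot : {dot H for Num.conj}) (dotE : hilbert_norm dot)
    (H_separable : separable_space H)
    (H_infinite : ~ finite_dimensional H)
    (CH : continuum_hypothesis) :
  exists V : ultrafilter nat,
    nonprincipal V /\ F_ultra (LH H) V = F_scalars (LH H) V.
Proof.
have [u u1] := exists_unit_vector dotE H_infinite.
have [code codeI] := separable_op_seq_code H_separable.
pose good (a : nat -> LH H) (Y : set nat) :=
  (exists b d, 0 < d /\ forall n, Y n -> d <= `|commutator b (a n)|) \/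
  (forall d, 0 < d ->
    \forall n \near \oo, Y n -> `|a n - dot (a n u) u *: nalg_one| < d).
have good_dense a X : infinite_set X ->
    exists Y, [/\ Y `<=` X, infinite_set Y & good a Y].
  move=> Xinf.
  have [|/existsNP[b /existsNP[d /not_implyP[d0 /infinite_not_near Yinf]]]] :=
    pselect (forall b d, 0 < d ->
      \forall n \near \oo, X n -> `|commutator b (a n)| < d).
    by move=> acomm; exists X; split=> //; right; exact: central_sequence.
  eexists; split; [|exact: Yinf|]; first by move=> n [].
  left; exists b, d; split=> // n [_ /negP].
  by rewrite -real_leNgt ?normr_real ?gtr0_real.
(* An index outside the range of [code] imposes no condition; by injectivity, any other index
   concerns a single sequence. *)
have [V [ooV VY]] : exists V : ultrafilter nat, \oo `<=` ultra_sets V /\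
    forall i, exists2 Y, ultra_sets V Y & forall a, code a = i -> good a Y.
  apply: ch_generic_ultrafilter CH _ => i X Xinf.
  have [[a ai]|na] := pselect (exists a, code a = i); last first.
    by exists X; split=> // a ai; case: na; exists a.
  have [Y [YX Yinf aY]] := good_dense a X Xinf.
  exists Y; split; [exact: YX|exact: Yinf|move=> a'].
  by rewrite -ai => /codeI ->; exact: aY.
exists V; split; first exact: nonprincipal_cofinite.
apply/seteqP; split=> [_ [x xcomm <-]|_ [k _ <-]]; last first.
  by exists (k *: (1 : ultrapower (LH H) V)) => //; exact: scalar_central.
(* Both sides are images under the same coset map, so it is enough that each element of the relative
   commutant is itself a scalar. *)
have [a xa] := upiP x; rewrite {}xa in xcomm *.
suff [k ->] : exists k : R[i], upi V a = k *: (1 : ultrapower (LH H) V)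
  by exists k.
have [Y YV /(_ a erefl)[[b [d [d0 bd]]]|alim]] := VY (code a).
  (* Commuting with [b] in the ultrapower makes the commutators smaller than [d] on a set in [V],
     which must meet [Y]. *)
  have : upi V (linfty_cst b) * upi V a = upi V a * upi V (linfty_cst b).
    by apply: xcomm; exists b.
  rewrite [LHS]upiM [RHS]upiM => /upi_eq/c_ultraP/(_ d d0) bVd.
  have [n [/bd dn abn]] := filter_ex (filterI YV bVd).
  have /(le_lt_trans dn) : `|commutator b (a n)| < d := abn.
  by rewrite ltxx.
(* These scalars are bounded, hence converge along [V]; their limit is the scalar [k]. *)
pose l n := dot (a n u) u.
have /bounded_seqP[M aM] := linfty_bounded a.
have u_norm := dot_unit_norm dotE u1.
have lM n : `|l n| <= M.
  rewrite (le_trans (norm_dot dotE _ _))// u_norm mulr1.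
  by rewrite (le_trans (op_norm_ub _ _))// u_norm mulr1.
have [k lk] := bounded_ultra_cvgC V lM.
exists k.
have -> : k *: (1 : ultrapower (LH H) V) = upi V (k *: (1 : linfty _)).
  exact: upiZ.
apply/upi_eq/c_ultraP => e e0.
have e2 : 0 < e / 2 by rewrite divr_gt0.
apply: filterS3 YV (ooV _ (alim _ e2)) (lk _ e2) => n Yn /(_ Yn) an ln.
have -> : (a - k *: (1 : linfty (LH H))) n =
    (a n - l n *: nalg_one) + (l n - k) *: (nalg_one : LH H).
  by rewrite scalerBl addrA subrK.
rewrite (le_lt_trans (ler_normD _ _))// (splitr e) ltrD//.
rewrite normrZ (le_lt_trans _ ln)// ler_piMr//.
by apply: op_norm_le => // y; rewrite mul1r.
Qed.
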